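(* Let $W=(W_1,\ldots,W_n)$ be a weighted left multi-shift associated with $\{\mu_\beta\}_{|\beta|\ge1}$. Then the following statements hold. (i) The $C^*$-algebra $C^*(W)$ is irreducible if and only if $\mu_\beta>0$ for every $\beta\in\mathbb F_n^+$ with $|\beta|\ge1$. (ii) If $W$ is injective and there is $i\in\{1,\ldots,n\}$ such that $\lim_{\alpha\to\infty}(\mu_{g_i\alpha}-\mu_\alpha)=0$, then $C^*(W)$ contains all the compact operators in $B(F^2(H_n))$. In particular, if $\{\mu_\alpha\}_\alpha$ is a convergent sequence, then the limit condition holds for every $i\in\{1,\ldots,n\}$.
   Context: Let $n\ge 1$ and let $\mathbb F_n^+$ be the unital free semigroup on generators $g_1,\ldots,g_n$ with identity $g_0$; $|\alpha|$ is the length of $\alpha$. $F^2(H_n)$ is the full Fock space, a Hilbert space with orthonormal basis $\{e_\alpha\}_{\alpha\in\mathbb F_n^+}$. The weighted left multi-shift associated with weights $\mu_\beta\ge0$ ($|\beta|\ge1$) satisfying $\sup_\alpha\mu_{g_i\alpha}<\infty$ for each $i$ (standing assumption) is $W=(W_1,\ldots,W_n)$, $W_ie_\alpha=\mu_{g_i\alpha}e_{g_i\alpha}$. $W$ is injective if each $W_i$ is injective, equivalently all $\mu_\beta>0$. $C^*(W)$ is the $C^*$-algebra generated by $W_1,\ldots,W_n$ and the identity. Limits as $\alpha\to\infty$ are along $\mathbb F_n^+$ with $|\alpha|\to\infty$ (equivalently, along an enumeration of $\mathbb F_n^+$). *)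

(* Defs.v *)
From mathcomp Require Export all_boot all_order all_algebra.
From mathcomp Require Export all_classical all_reals all_analysis.
From mathcomp Require Export complex.

Set Implicit Arguments.
Unset Strict Implicit.
Unset Printing Implicit Defensive.

Import Order.TTheory GRing.Theory Num.Theory.
Import numFieldNormedType.Exports.

Local Open Scope classical_set_scope.
Local Open Scope ring_scope.
Local Open Scope complex_scope.

(* The free semigroup on g_1, ..., g_n is [seq 'I_n]: the identity g_0 is [::],
   the length is [size], and g_i alpha is [i :: alpha]. *)

(* The filter generated by the sets of words of length at least N. As there are
   finitely many words of each length, it is the filter of cofinite sets. *)
Definition words_infty (n : nat) : set_system (seq 'I_n) :=
  filter_from [set: nat] (fun N => [set alpha | (N <= size alpha)%N]).

Section Hilbert.
Variables (R : realType) (H : completeNormedModType R[i]).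

(* [dot] is linear in its first argument and conjugate-linear in the second;
   with this property the Banach space H is a complex Hilbert space. *)
Definition norm_from_dot (dot : {dot H for Num.conj}) : Prop :=
  forall x : H, `|x| ^+ 2 = dot x x.

Definition linear_span (I : eqType) (e : I -> H) : set H :=
  [set x | exists (s : seq I) (c : I -> R[i]), x = \sum_(a <- s) c a *: e a].

Definition orthonormal_basis (dot : {dot H for Num.conj}) (I : eqType)
    (e : I -> H) : Prop :=
  (forall a b : I, dot (e a) (e b) = (a == b)%:R) /\
  closure (linear_span e) = [set: H].

Definition bounded_operator (A : H -> H) : Prop := linear A /\ continuous A.

Definition adjoint (dot : {dot H for Num.conj}) (A B : H -> H) : Prop :=
  forall x y : H, dot (A x) y = dot x (B y).

(* The operator norm of A is at most r. *)
Definition opnorm_le (A : H -> H) (r : R) : Prop :=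
  forall x : H, `|A x| <= r%:C * `|x|.

Definition opnorm_closed (S : set (H -> H)) : Prop :=
  forall A : H -> H, bounded_operator A ->
    (forall r : R, 0 < r -> exists2 B, S B & opnorm_le (A \- B) r) -> S A.

Record unital_cstar_subalgebra (dot : {dot H for Num.conj})
    (S : set (H -> H)) : Prop := {
  cstar_bounded : S `<=` bounded_operator;
  cstar_id : S idfun;
  cstar_add : forall A B, S A -> S B -> S (A \+ B);
  cstar_scale : forall (c : R[i]) A, S A -> S (fun x => c *: A x);
  cstar_comp : forall A B, S A -> S B -> S (A \o B);
  cstar_adjoint : forall A B,
    S A -> bounded_operator B -> adjoint dot A B -> S B;
  cstar_closed : opnorm_closed S }.

(* The C*-algebra generated by the operators W_i and the identity. *)
Definition cstar_algebra (dot : {dot H for Num.conj}) (I : Type)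
    (W : I -> H -> H) : set (H -> H) :=
  smallest (unital_cstar_subalgebra dot) (range W).

Definition closed_subspace (M : set H) : Prop :=
  [/\ M 0, (forall (c : R[i]) x y, M x -> M y -> M (c *: x + y)) & closed M].

Definition irreducible_algebra (S : set (H -> H)) : Prop :=
  forall M : set H, closed_subspace M ->
    (forall A, S A -> A @` M `<=` M) -> M = [set 0] \/ M = [set: H].

Definition compact_operator (A : H -> H) : Prop :=
  bounded_operator A /\ compact (closure (A @` [set x | `|x| <= 1])).

(* Only the values of mu on nonempty words matter. *)
Record weighted_left_multishift (n : nat) (e : seq 'I_n -> H)
    (mu : seq 'I_n -> R) (W : 'I_n -> H -> H) : Prop := {
  weight_ge0 : forall beta, (1 <= size beta)%N -> 0 <= mu beta;
  weight_bounded : forall i, has_ubound (range (fun alpha => mu (i :: alpha)));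
  shift_bounded : forall i, bounded_operator (W i);
  shift_basis : forall i alpha,
    W i (e alpha) = (mu (i :: alpha))%:C *: e (i :: alpha) }.

End Hilbert.

(* Main.v *)
(* If mu vanishes at some beta <> g_0, the vectors supported on the words with
   suffix beta form a proper reducing subspace.  Conversely, when all weights
   are positive, the common kernel of the W_j^* is spanned by e_{g_0}; the
   projection of e_{g_0} to a reducing subspace M lies in this kernel, so
   e_{g_0} is in M or orthogonal to M, and the W_j propagate this to the whole
   basis.
   For the compact operators, let T = \sum_j W_j W_j^*, d = mu_{g_i}^2 and
   X = W_i^* W_i - T - d.  The operator E = T + X^2 is diagonal and kills
   e_{g_0}; the limit condition makes the entries of X tend to -d, so the other
   entries of E are bounded away from 0.  Hence (1 - c E)^k tends in norm to the
   projection on e_{g_0} for small c > 0; multiplying by words in W on the left and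
   in W^* on the right gives the rank one operators on the basis, hence all
   compact operators. *)
From HB Require Import structures.
Require Import Defs.
From mathcomp Require Import all_boot all_order all_algebra.
From mathcomp Require Import all_classical all_reals all_analysis.
From mathcomp Require Import complex ring lra.

Import Order.TTheory GRing.Theory Num.Theory.
Import numFieldNormedType.Exports.
Local Open Scope classical_set_scope.
Local Open Scope ring_scope.

Set Implicit Arguments.
Unset Strict Implicit.
Unset Printing Implicit Defensive.

(** * Inner product geometry and bounded linear operators *)

Section InnerProduct.
Variables (R : realType) (H : completeNormedModType R[i]).
Variable dot : {dot H for Num.conj}.
Hypothesis dotP : norm_from_dot dot.

Lemma dotC x y : dot x y = Num.conj (dot y x).
Proof. by rewrite (hermC dot) expr0 mul1r. Qed.

Lemma dotZl c x y : dot (c *: x) y = c * dot x y.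
Proof. by rewrite linearZl_LR. Qed.

Lemma dotZr c x y : dot x (c *: y) = Num.conj c * dot x y.
Proof. by rewrite linearZr_LR. Qed.

Lemma dotDl x y z : dot (x + y) z = dot x z + dot y z.
Proof. by rewrite linearDl. Qed.

Lemma dotBl x y z : dot (x - y) z = dot x z - dot y z.
Proof. by rewrite linearBl. Qed.

Lemma dotDr x y z : dot z (x + y) = dot z x + dot z y.
Proof. by rewrite linearDr. Qed.

Lemma dotBr x y z : dot z (x - y) = dot z x - dot z y.
Proof. by rewrite linearBr. Qed.

Lemma dot_suml I (s : seq I) (F : I -> H) z :
  dot (\sum_(i <- s) F i) z = \sum_(i <- s) dot (F i) z.
Proof. by rewrite linear_sumlz. Qed.

Lemma dot_sumr I (s : seq I) (F : I -> H) z :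
  dot z (\sum_(i <- s) F i) = \sum_(i <- s) dot z (F i).
Proof. by rewrite linear_sumr. Qed.

Lemma dot_eq0C x y : dot x y = 0 -> dot y x = 0.
Proof. by move=> xy0; rewrite dotC xy0 rmorph0. Qed.

Lemma norm_pythagoras x y : dot x y = 0 -> `|x + y| ^+ 2 = `|x| ^+ 2 + `|y| ^+ 2.
Proof. by move=> xy0; rewrite !dotP hnormDd. Qed.

Lemma norm_le_sqr (x y : H) : `|x| ^+ 2 <= `|y| ^+ 2 -> `|x| <= `|y|.
Proof. by rewrite ler_pXn2r// ?nnegrE. Qed.

Lemma norm_le_pythagoras x y : dot x y = 0 -> `|x| <= `|x + y|.
Proof.
by move=> xy0; apply: norm_le_sqr; rewrite norm_pythagoras// lerDl exprn_ge0.
Qed.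

Lemma dot_sub_line x y : y != 0 -> dot (x - (dot x y / `|y| ^+ 2) *: y) y = 0.
Proof.
move=> y0; rewrite dotBl dotZl -dotP divfK ?subrr//.
by rewrite expf_neq0// normr_eq0.
Qed.

(** [c *: y] is the component of [x] along [y]; by Pythagoras its norm, computed in [cy], is at most
    that of [x]. *)
Lemma cauchy_schwarz x y : `|dot x y| <= `|x| * `|y|.
Proof.
have [->|y0] := eqVneq y 0; first by rewrite linear0r !normr0 mulr0.
have ny0 : 0 < `|y| by rewrite normr_gt0.
have := dot_sub_line x y0; set c := dot x y / _ => ort.
have cy : `|c *: y| = `|dot x y| / `|y|.
  rewrite normrZ /c normrM normfV normrX normr_id expr2 invfM mulrA.
  by rewrite divfK// gt_eqF.
rewrite -ler_pdivrMr// -cy -[x in leRHS](subrK (c *: y)) addrC.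
by apply: norm_le_pythagoras; rewrite dotZl (dot_eq0C ort) mulr0.
Qed.

Lemma linear_opB (A : H -> H) x y : linear A -> A (x - y) = A x - A y.
Proof.
by move=> lA; rewrite -scaleN1r addrC lA scaleN1r addrC.
Qed.

Lemma linear_opD (A : H -> H) x y : linear A -> A (x + y) = A x + A y.
Proof. by move=> lA; rewrite -[x]scale1r lA !scale1r. Qed.

Lemma linear_op0 (A : H -> H) : linear A -> A 0 = 0.
Proof. by move=> lA; have := linear_opB 0 0 lA; rewrite !subrr. Qed.

Lemma linear_opZ (A : H -> H) c x : linear A -> A (c *: x) = c *: A x.
Proof. by move=> lA; rewrite -[c *: x]addr0 lA linear_op0// addr0. Qed.

Lemma linear_op_sum (A : H -> H) I (s : seq I) (F : I -> H) : linear A ->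
  A (\sum_(i <- s) F i) = \sum_(i <- s) A (F i).
Proof.
move=> lA; apply: (big_morph A); last exact: linear_op0.
by move=> x y; exact: linear_opD.
Qed.

Lemma bounded_opP (A : H -> H) : bounded_operator A <->
  linear A /\ exists2 M : R[i], 0 < M & forall x, `|A x| <= M * `|x|.
Proof.
split=> [[lA cA]|[lA [M M0 AM]]]; split=> //.
  pose f : {linear H -> H} := HB.pack A (GRing.isLinear.Build _ _ _ _ A lA).
  have /linear_bounded_continuous/linear_boundedP/pinfty_ex_gt0 : continuous f by [].
  by move=> [M M0 fM]; exists M.
pose f : {linear H -> H} := HB.pack A (GRing.isLinear.Build _ _ _ _ A lA).
suff : continuous f by [].
apply/linear_bounded_continuous/bounded_funP => r; exists (M * r) => x xr.
by rewrite (le_trans (AM x))// ler_pM2l.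
Qed.

(** Limit arguments produce an error [k * d] with a constant [k] such as an operator bound;
    rescaling [d] absorbs it. *)
Lemma le_eps (x y k : R[i]) : 0 < k -> (forall d, 0 < d -> x <= y + k * d) -> x <= y.
Proof.
move=> k0 xy; apply/ler_addgt0Pr => d d0.
by have := xy _ (divr_gt0 d0 k0); rewrite mulrC divfK// gt_eqF.
Qed.

End InnerProduct.

(** * Finite projections and expansions in an orthonormal basis *)

Section OrthonormalBasis.
Variables (R : realType) (H : completeNormedModType R[i]).
Variable dot : {dot H for Num.conj}.
Hypothesis dotP : norm_from_dot dot.
Variables (I : eqType) (e : I -> H).
Hypothesis e_basis : orthonormal_basis dot e.

(** The orthogonal projection onto the span of the [e a] with [a] in [s]; [undup] keeps repeated
    indices from counting twice. *)
Definition basis_proj (s : seq I) (x : H) : H :=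
  \sum_(a <- undup s) dot x (e a) *: e a.

Lemma dot_basis a b : dot (e a) (e b) = (a == b)%:R.
Proof. by case: e_basis. Qed.

Lemma dot_comb s (c : I -> R[i]) b : uniq s ->
  dot (\sum_(a <- s) c a *: e a) (e b) = if b \in s then c b else 0.
Proof.
move=> us; rewrite dot_suml; case: ifPn => bs.
  rewrite (bigD1_seq b)//= dotZl dot_basis eqxx mulr1 big1 ?addr0// => a ab.
  by rewrite dotZl dot_basis (negbTE ab) mulr0.
rewrite big1_seq// => a /= as_; rewrite dotZl dot_basis.
by case: eqP => [ab|_]; rewrite ?mulr0//; rewrite -ab as_ in bs.
Qed.

Lemma dot_basis_proj s x b : b \in s ->
  dot (basis_proj s x) (e b) = dot x (e b).
Proof. by move=> bs; rewrite dot_comb ?undup_uniq// mem_undup bs. Qed.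

(** The residual is orthogonal to the span over [s], which contains both the projection and the
    competing combination, so Pythagoras applies. *)
Lemma basis_proj_best s r x (c : I -> R[i]) : {subset r <= s} ->
  `|x - basis_proj s x| <= `|x - \sum_(a <- r) c a *: e a|.
Proof.
move=> rs; rewrite -[x in leRHS](subrK (basis_proj s x)) -addrA.
have ort b : b \in s -> dot (x - basis_proj s x) (e b) = 0.
  by move=> bs; rewrite dotBl dot_basis_proj// subrr.
apply: norm_le_pythagoras => //; rewrite dotBr; move: (x - _) ort => z ort.
rewrite /basis_proj !dot_sumr !big1_seq ?subrr// => a /=; last first.
  by rewrite mem_undup => as_; rewrite dotZr ort ?mulr0.
by move=> ar; rewrite dotZr ort ?mulr0//; exact: rs.
Qed.

(** The free [y] lets an approximation found for one vector serve all nearby vectors. *)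
Lemma basis_proj_mono s r x y : {subset r <= s} ->
  `|x - basis_proj s x| <= `|x - basis_proj r y|.
Proof.
by move=> rs; apply: basis_proj_best => a; rewrite mem_undup; exact: rs.
Qed.

Lemma norm_basis_proj s x : `|basis_proj s x| <= `|x|.
Proof.
rewrite -[x in leRHS](subrK (basis_proj s x)) addrC.
apply: norm_le_pythagoras => //; apply: dot_eq0C.
rewrite {2}/basis_proj dot_sumr big1_seq// => a; rewrite mem_undup => /andP[_ as_].
by rewrite dotZr dotBl dot_basis_proj// subrr mulr0.
Qed.

Lemma basis_proj_dense x (eps : R[i]) : 0 < eps ->
  exists s, `|x - basis_proj s x| < eps.
Proof.
move=> eps0; have /(_ (ball x eps)) : closure (linear_span e) x.
  by case: e_basis => _ ->.
case; first exact: nbhsx_ballx.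
move=> _ [[s [c ->]]]; rewrite -ball_normE /= => xs; exists s.
exact: le_lt_trans (basis_proj_best _ _ _) xs.
Qed.

Lemma basis_eq0 x : (forall a, dot x (e a) = 0) -> x = 0.
Proof.
move=> x0; apply/normr0_eq0/le_anti; rewrite normr_ge0 andbT.
apply/ler_addgt0Pr => d /(basis_proj_dense x)[s].
by rewrite /basis_proj big1 => [|a _]; rewrite ?x0 ?scale0r// subr0 add0r => /ltW.
Qed.

Lemma basis_ext x y : (forall a, dot x (e a) = dot y (e a)) -> x = y.
Proof.
move=> xy; apply/subr0_eq/basis_eq0 => a; by rewrite dotBl xy subrr.
Qed.

Lemma norm_comb s (c : I -> R[i]) : uniq s ->
  `|\sum_(a <- s) c a *: e a| ^+ 2 = \sum_(a <- s) `|c a| ^+ 2.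
Proof.
move=> us; rewrite dotP dot_sumr; apply: eq_big_seq => a as_.
by rewrite dotZr dot_comb// as_ mulrC -normCK.
Qed.

(** On finite combinations of the basis the bound follows from [norm_comb]; the unspecified bound
    [M] of [A] controls the rest, which can be made arbitrarily small. *)
Lemma diag_opnorm (A : H -> H) (d : I -> R[i]) (r : R[i]) :
  bounded_operator A -> 0 <= r -> (forall a, A (e a) = d a *: e a) ->
  (forall a, `|d a| <= r) -> forall x, `|A x| <= r * `|x|.
Proof.
move=> /bounded_opP[lA [M M0 AM]] r0 Ae dr x.
apply: (le_eps M0) => eps /(basis_proj_dense x)[s xs].
rewrite -[x in leLHS](subrK (basis_proj s x)) (linear_opD _ _ lA) addrC.
apply: (le_trans (ler_normD _ _)); apply: lerD; last first.
  by rewrite (le_trans (AM _))// ler_pM2l// ltW.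
apply: (@le_trans _ _ (r * `|basis_proj s x|)); last first.
  by rewrite ler_wpM2l// norm_basis_proj.
rewrite -(@ler_pXn2r _ 2)// ?nnegrE ?mulr_ge0// exprMn.
rewrite /basis_proj (linear_op_sum _ _ lA).
under eq_bigr => a _ do rewrite (linear_opZ _ _ lA) Ae scalerA.
rewrite !norm_comb ?undup_uniq// mulr_sumr; apply: ler_sum => a _.
by rewrite normrM mulrC exprMn ler_wpM2r// ?exprn_ge0// lerXn2r// nnegrE.
Qed.

End OrthonormalBasis.

(** * Orthogonal projection onto a closed subspace *)

Section Projection.
Variables (R : realType) (H : completeNormedModType R[i]).
Variable dot : {dot H for Num.conj}.
Hypothesis dotP : norm_from_dot dot.

Lemma parallelogram (x y : H) :
  `|x + y| ^+ 2 + `|x - y| ^+ 2 = (`|x| ^+ 2 + `|y| ^+ 2) *+ 2.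
Proof.
rewrite !dotP !(dotBl, dotBr, dotDl, dotDr) mulr2n.
set a := dot x x; set b := dot x y; set c := dot y x; set d := dot y y.
ring.
Qed.

Lemma closure_ballP (M : set H) x : closure M x <->
  forall eps : R[i], 0 < eps -> exists2 y, M y & `|x - y| < eps.
Proof.
split=> [Mx eps eps0|Mx U /nbhs_ballP[eps eps0 epsU]].
  have [y [My xy]] := Mx _ (nbhsx_ballx x _ eps0).
  by exists y => //; move: xy; rewrite -ball_normE.
have [y My xy] := Mx _ eps0; exists y; split => //; apply: epsU.
by rewrite -ball_normE.
Qed.

(** Removing from [z] its component along [m] lowers the squared norm by that of the component,
    which minimality therefore forces to be 0. *)
Lemma dot_eq0_closest (z m : H) :
  (forall c : R[i], `|z| <= `|z - c *: m|) -> dot z m = 0.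
Proof.
move=> zm; have [->|m0] := eqVneq m 0; first by rewrite linear0r.
have := dot_sub_line dotP z m0; set c := dot z m / _ => ort.
have := norm_pythagoras dotP (_ : dot (z - c *: m) (c *: m) = 0).
rewrite subrK dotZr ort mulr0 => /(_ erefl) zE.
have /eqP : `|c *: m| ^+ 2 = 0.
  apply/le_anti; rewrite exprn_ge0// andbT.
  rewrite -(lerD2l (`|z - c *: m| ^+ 2)) -zE addr0.
  by rewrite ler_pXn2r// ?nnegrE.
rewrite expf_eq0/= normr_eq0 scaler_eq0 (negbTE m0) orbF mulf_eq0 invr_eq0.
by rewrite expf_eq0/= normr_eq0 (negbTE m0) orbF => /eqP.
Qed.

Lemma exists_closest (M : set H) x : closed_subspace M ->
  exists2 p, M p & forall m, M m -> `|x - p| <= `|x - m|.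
Proof.
move=> [M0 Mlin Mclosed].
(* Norms live in [R[i]], so the infimum is taken over the real numbers equal to a squared
   distance. *)
pose E : set R := [set r | exists2 m, M m & (r%:C)%C = `|x - m| ^+ 2].
have realC (z : R[i]) : 0 <= z -> z = ((complex.Re z)%:C)%C.
  by move=> z0; rewrite RRe_real// ger0_real.
have Elb : lbound E 0.
  by move=> r [m _ rE]; rewrite -(lecR 0 r) rE exprn_ge0.
have Einf : has_inf E.
  split; last by exists 0.
  by exists (complex.Re (`|x - 0| ^+ 2)), 0 => //; rewrite -realC// exprn_ge0.
pose d := inf E.
have dle m : M m -> (d%:C)%C <= `|x - m| ^+ 2.
  move=> Mm; rewrite [leRHS]realC ?exprn_ge0// lecR; apply: ge_inf; first by exists 0.
  by exists m => //; rewrite -realC// exprn_ge0.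
pose near_min (eps : R) : set H := [set m | M m /\ `|x - m| ^+ 2 < ((d + eps)%:C)%C].
pose F := filter_from [set eps : R | 0 < eps] near_min.
have nm_ex eps : 0 < eps -> near_min eps !=set0.
  move=> eps0; have [r [m Mm rE] rd] := inf_adherent eps0 Einf.
  by exists m; split => //; rewrite -rE ltcR.
have FF : ProperFilter F.
  apply: filter_from_proper => //; apply: filter_from_filter; first by exists 1 => /=.
  move=> a b /= a0 b0; exists (Num.min a b); first by rewrite /= lt_min a0.
  move=> m [Mm xm]; split; split=> //; apply: (lt_le_trans xm); rewrite lecR lerD2l.
    by rewrite ge_min lexx.
  by rewrite ge_min lexx orbT.
(* The midpoint of [m] and [m'] lies in [M], so its squared distance to [x] is at least [d]; the
   parallelogram law then makes [m] and [m'] close. *)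
have nm_close eps m m' : near_min eps m -> near_min eps m' ->
    `|m - m'| ^+ 2 < (eps%:C)%C *+ 4.
  move=> [Mm xm] [Mm' xm'].
  have Mmid : M (2^-1 *: m + 2^-1 *: m').
    apply: (Mlin) => //; rewrite -[_ *: m']addr0; exact: Mlin.
  have := parallelogram (x - m) (x - m').
  have -> : x - m - (x - m') = m' - m by rewrite opprB addrC addrA subrK.
  have -> : x - m + (x - m') = 2 *: (x - (2^-1 *: m + 2^-1 *: m')).
    rewrite scalerBr scalerDr !scalerA mulfV ?pnatr_eq0// !scale1r scaler_nat mulr2n.
    by rewrite opprD addrACA.
  rewrite normrZ exprMn normr_nat (distrC m' m) => par.
  have mid := dle _ Mmid.
  have -> : `|m - m'| ^+ 2 = (`|x - m| ^+ 2 + `|x - m'| ^+ 2) *+ 2 -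
     2 ^+ 2 * `|x - (2^-1 *: m + 2^-1 *: m')| ^+ 2
    by rewrite -par addrAC subrr add0r.
  rewrite ltrBlDr; apply: (@lt_le_trans _ _ (((d + eps)%:C)%C *+ 4)).
    by rewrite -[4%N]/(2 * 2)%N mulrnA ltrMn2r//= mulr2n ltrD.
  rewrite rmorphD mulrnDl addrC lerD2l.
  have -> : 2 ^+ 2 = 4%:R :> R[i] by rewrite expr2 -natrM.
  by rewrite mulr_natl lerMn2r.
have Fcauchy : cauchy F.
  apply: cauchy_exP => eps eps0.
  have epsE := realC _ (ltW eps0).
  (* Chosen so that the bound from [nm_close] becomes [eps ^+ 2]. *)
  pose eta := (complex.Re eps) ^+ 2 / 4.
  have eta0 : 0 < eta.
    by rewrite divr_gt0// exprn_gt0// -(ltcR 0) -epsE.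
  have [m nm] := nm_ex _ eta0.
  exists m, eta => // m' nm'; rewrite -ball_normE /=.
  have := nm_close _ _ _ nm nm'.
  have -> : (eta%:C)%C *+ 4 = eps ^+ 2 :> R[i].
    rewrite epsE -rmorphXn -rmorphMn /eta /=; congr ((_)%:C)%C.
    by rewrite -mulr_natr divfK// pnatr_eq0.
  by rewrite ltr_pXn2r// ?nnegrE// ltW.
have Fp := cauchy_cvg _ Fcauchy; pose p := lim F; rewrite -/p in Fp.
(* A margin [eps ^+ 2] for squared distances gives a margin [eps] for distances, because the square
   of a sum of nonnegative terms dominates the sum of their squares. *)
have p_close (eps : R[i]) : 0 < eps -> exists2 m, M m &
    `|p - m| < eps /\ forall m', M m' -> `|x - m| <= `|x - m'| + eps.
  move=> eps0; have epsE := realC _ (ltW eps0).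
  have eta0 : 0 < complex.Re eps ^+ 2 by rewrite exprn_gt0// -(ltcR 0) -epsE.
  have : F (ball p eps `&` near_min (complex.Re eps ^+ 2)).
    apply: filterI; first exact/Fp/nbhsx_ballx.
    by exists (complex.Re eps ^+ 2).
  move=> /filter_ex[m [pm [Mm xm]]]; exists m => //; split.
    by move: pm; rewrite -ball_normE.
  move=> m' /dle dm'; rewrite -(@ler_pXn2r _ 2)// ?nnegrE ?addr_ge0 ?(ltW eps0)//.
  apply: (le_trans (ltW xm)); rewrite rmorphD rmorphXn /= -epsE sqrrD.
  rewrite addrAC -[leLHS]addr0 lerD//; first by rewrite lerD2r.
  by rewrite mulrn_wge0// mulr_ge0// ltW.
exists p.
  by apply/Mclosed/closure_ballP => eps /p_close[m Mm [pm _]]; exists m.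
move=> m Mm; apply: (@le_eps _ _ _ 2) => // eps eps0.
have [m' Mm' [pm' xm']] := p_close _ eps0.
have -> : x - p = (x - m') - (p - m') by rewrite opprB addrA subrK.
rewrite (le_trans (ler_normB _ _))// mulr_natl mulr2n addrA lerD//; last exact: ltW.
exact: xm'.
Qed.

Lemma exists_proj (M : set H) x : closed_subspace M ->
  exists2 p, M p & forall m, M m -> dot (x - p) m = 0.
Proof.
move=> Mcs; have [p Mp pmin] := exists_closest x Mcs.
exists p => // m Mm; apply: dot_eq0_closest => c.
rewrite -addrA -opprD; apply: pmin; rewrite addrC.
by case: Mcs => _ + _; apply.
Qed.

End Projection.

(** * Riesz representation and existence of adjoints *)

Section Adjoint.
Variables (R : realType) (H : completeNormedModType R[i]).
Variable dot : {dot H for Num.conj}.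
Hypothesis dotP : norm_from_dot dot.

(** For nonzero [f], take a nonzero [w] orthogonal to its kernel: [x - (f x / f w) *: w] lies in the
    kernel, and pairing it with [w] determines [f x]. *)
Lemma riesz (f : H -> R[i]) (M : R[i]) : 0 < M ->
  (forall c x y, f (c *: x + y) = c * f x + f y) ->
  (forall x, `|f x| <= M * `|x|) -> exists z, forall x, f x = dot x z.
Proof.
move=> M0 flin fM.
have f0 : f 0 = 0.
  by apply/normr0_eq0/le_anti; rewrite normr_ge0 andbT (le_trans (fM _))// normr0 mulr0.
have fZ c x : f (c *: x) = c * f x by rewrite -[c *: x]addr0 flin f0 addr0.
have fB x y : f (x - y) = f x - f y by rewrite addrC -scaleN1r flin mulN1r addrC.
have [fz|] := pselect (forall x, f x = 0).
  by exists 0 => x; rewrite linear0r.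
move=> /existsNP[u /eqP fu].
have kerf : closed_subspace [set x | f x = 0].
  split=> //= [c x y fx fy|x /closure_ballP xker].
    by rewrite flin fx fy mulr0 addr0.
  apply/normr0_eq0/le_anti; rewrite normr_ge0 andbT.
  apply: (le_eps M0) => d /xker[y /= fy xy].
  have -> : f x = f (x - y) by rewrite fB fy subr0.
  by rewrite add0r (le_trans (fM _))// ler_pM2l// ltW.
have [p /= fp up] := exists_proj dotP u kerf.
pose w := u - p.
have fw : f w != 0 by rewrite fB fp subr0.
have w0 : w != 0 by apply: contraNneq fw => ->; rewrite f0.
have dw0 : dot w w != 0 by rewrite dnorm_eq0.
exists (Num.conj (f w / dot w w) *: w) => x.
rewrite dotZr conjCK.
have xw : dot (x - (f x / f w) *: w) w = 0.
  by apply: dot_eq0C; apply: up => /=; rewrite fB fZ divfK ?subrr.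
move: xw; rewrite dotBl dotZl => /eqP; rewrite subr_eq0 => /eqP ->.
by field; rewrite dw0 fw.
Qed.

(** Riesz representation gives [B y] for each [y]; boundedness follows from
    [dot (B y) (B y) = dot (A (B y)) y]. *)
Lemma exists_adjoint (A : H -> H) : bounded_operator A ->
  exists2 B, bounded_operator B & adjoint dot A B.
Proof.
move=> /bounded_opP[lA [M M0 AM]].
have /choice[B AB] : forall y, exists z, forall x, dot (A x) y = dot x z.
  (* The [+ 1] keeps the Riesz bound positive when [y] is 0. *)
  move=> y; apply: (@riesz (fun x => dot (A x) y) (M * (`|y| + 1))).
  - by rewrite mulr_gt0// ltr_wpDl.
  - by move=> c x z; rewrite lA dotDl dotZl.
  - move=> x; rewrite (le_trans (cauchy_schwarz dotP _ _))// mulrAC.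
    by rewrite ler_pM// lerDl.
exists B => [|x y]; last exact: AB.
apply/bounded_opP; split.
  move=> c x y; apply/subr0_eq/eqP; rewrite -(dnorm_eq0 dot).
  by rewrite dotBr dotDr dotZr -!AB dotDr dotZr subrr.
exists M => // y; have [->|By0] := eqVneq (B y) 0; first by rewrite normr0 mulr_ge0 ?(ltW M0).
rewrite -(@ler_pM2r _ `|B y|) ?normr_gt0// -expr2 dotP -AB.
rewrite (le_trans (real_ler_norm _))//.
  by rewrite ger0_real// AB dnorm_ge0.
rewrite (le_trans (cauchy_schwarz dotP _ _))// mulrAC ler_wpM2r//.
Qed.

End Adjoint.

(** * Subspaces spanned by part of the basis, and the operators they reduce *)

Section ReducingSubspaces.
Variables (R : realType) (H : completeNormedModType R[i]).
Variable dot : {dot H for Num.conj}.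
Hypothesis dotP : norm_from_dot dot.
Variables (I : eqType) (e : I -> H).
Hypothesis e_basis : orthonormal_basis dot e.

Lemma bounded_op_id : bounded_operator (idfun : H -> H).
Proof. by apply/bounded_opP; split=> //; exists 1 => // x; rewrite mul1r. Qed.

Lemma bounded_opD (A B : H -> H) :
  bounded_operator A -> bounded_operator B -> bounded_operator (A \+ B).
Proof.
move=> /bounded_opP[lA [M M0 AM]] /bounded_opP[lB [N N0 BN]].
apply/bounded_opP; split=> [c x y|]; first by rewrite /= lA lB scalerDr addrACA.
exists (M + N) => [|x]; first exact: addr_gt0.
by rewrite (le_trans (ler_normD _ _))// mulrDl lerD.
Qed.

Lemma bounded_opZ c (A : H -> H) :
  bounded_operator A -> bounded_operator (fun x => c *: A x).
Proof.
move=> /bounded_opP[lA [M M0 AM]]; apply/bounded_opP; split=> [d x y|].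
  by rewrite /= lA scalerDr !scalerA mulrC.
exists ((`|c| + 1) * M) => [|x]; first by rewrite mulr_gt0// ltr_wpDl.
by rewrite normrZ -mulrA ler_pM// lerDl.
Qed.

Lemma bounded_op_comp (A B : H -> H) :
  bounded_operator A -> bounded_operator B -> bounded_operator (A \o B).
Proof.
move=> /bounded_opP[lA [M M0 AM]] /bounded_opP[lB [N N0 BN]].
apply/bounded_opP; split=> [c x y|]; first by rewrite /= lB lA.
exists (M * N) => [|x]; first exact: mulr_gt0.
by rewrite (le_trans (AM _))// -mulrA ler_pM2l.
Qed.

Lemma norm_basis a : `|e a| = 1.
Proof.
apply/eqP; rewrite -(@eqrXn2 _ 2)//; last by rewrite dotP dot_basis// eqxx expr1n.
Qed.

(** The closed span of the basis vectors with index outside [Q], given by coefficients so that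
    closedness comes from continuity of [dot]. *)
Definition vanish_on (Q : pred I) : set H :=
  [set x | forall b, Q b -> dot x (e b) = 0].

Lemma closed_vanish_on Q : closed_subspace (vanish_on Q).
Proof.
split=> [b _|c x y xQ yQ b Qb|x /closure_ballP xQ b Qb].
- by rewrite linear0l.
- by rewrite dotDl dotZl xQ// yQ// mulr0 addr0.
- apply/normr0_eq0/le_anti; rewrite normr_ge0 andbT.
  apply: (@le_eps _ _ _ 1) => // d /xQ[y yQ xy].
  rewrite add0r mul1r -[dot x _]subr0 -(yQ b Qb) -dotBl.
  by rewrite (le_trans (cauchy_schwarz dotP _ _))// norm_basis mulr1 ltW.
Qed.

Lemma dot_vanish_on Q x y :
  vanish_on Q x -> vanish_on (predC Q) y -> dot x y = 0.
Proof.
move=> xQ yQ; apply/normr0_eq0/le_anti; rewrite normr_ge0 andbT.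
apply: (@le_eps _ _ _ (`|y| + 1)); first by rewrite ltr_wpDl.
move=> d /(basis_proj_dense dotP e_basis x)[s xs]; rewrite add0r.
have Ps0 : dot (basis_proj dot e s x) y = 0.
  rewrite dot_suml big1// => a _; rewrite dotZl.
  have [Qa|Qa] := boolP (Q a); first by rewrite xQ// mul0r.
  by rewrite (dot_eq0C (yQ _ Qa)) mulr0.
rewrite -[dot x y]subr0 -Ps0 -dotBl mulrC.
rewrite (le_trans (cauchy_schwarz dotP _ _))//.
by rewrite ler_pM// ?ltW// ltrDl.
Qed.

(** Invariance of the complementary subspace is included to make the class stable under adjoints. *)
Definition reduced_by (Q : pred I) : set (H -> H) :=
  [set A | [/\ bounded_operator A, A @` vanish_on Q `<=` vanish_on Q &
               A @` vanish_on (predC Q) `<=` vanish_on (predC Q)]].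

(** For [Q b], the vector [e b] lies in the complementary subspace, so [A (e b)] does too and is
    orthogonal to [x]; moving [A] across gives the coefficient of [B x] at [b]. *)
Lemma vanish_on_adjoint Q (A B : H -> H) : adjoint dot A B ->
  A @` vanish_on (predC Q) `<=` vanish_on (predC Q) ->
  B @` vanish_on Q `<=` vanish_on Q.
Proof.
move=> AB AQ _ [x xQ <-] b Qb; apply: dot_eq0C; rewrite -AB.
apply: dot_eq0C; apply: (dot_vanish_on xQ); apply: AQ; exists (e b) => // a /= Qa.
by rewrite dot_basis//; case: eqP => // ba; rewrite -ba Qb in Qa.
Qed.

Lemma vanish_on_closed Q (A : H -> H) :
  (forall r : R, 0 < r ->
    exists2 B : H -> H, B @` vanish_on Q `<=` vanish_on Q & opnorm_le (A \- B) r) ->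
  A @` vanish_on Q `<=` vanish_on Q.
Proof.
move=> Acl _ [x xQ <-] b Qb; apply/normr0_eq0/le_anti; rewrite normr_ge0 andbT.
apply: (@le_eps _ _ _ (`|x| + 1)); first by rewrite ltr_wpDl.
move=> d d0; rewrite add0r mulrC.
have dE : ((complex.Re d)%:C)%C = d by rewrite RRe_real// gtr0_real.
have [|B BQ AB] := Acl (complex.Re d); first by rewrite -(ltcR 0) dE.
have Bx0 : dot (B x) (e b) = 0 by apply: BQ Qb; exists x.
rewrite -[dot _ _]subr0 -Bx0 -dotBl (le_trans (cauchy_schwarz dotP _ _))//.
rewrite norm_basis mulr1 (le_trans (AB x))// dE ler_wpM2l ?(ltW d0)//.
by rewrite lerDl.
Qed.

(** Reduces a statement about a generated algebra to a check on its generators. *)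
Lemma reduced_by_cstar Q : unital_cstar_subalgebra dot (reduced_by Q).
Proof.
have vD Q' c x y : vanish_on Q' x -> vanish_on Q' y -> vanish_on Q' (c *: x + y).
  by case: (closed_vanish_on Q') => _ + _; apply.
have v0 Q' : vanish_on Q' 0 by case: (closed_vanish_on Q').
split.
- by move=> A [].
- by split; [exact: bounded_op_id|move=> _ [x ? <-]|move=> _ [x ? <-]].
- move=> A B [bA A1 A2] [bB B1 B2]; split; first exact: bounded_opD.
    move=> _ [x xQ <-]; rewrite /= -[A x]scale1r; apply: vD.
      by apply: A1; exists x.
    by apply: B1; exists x.
  move=> _ [x xQ <-]; rewrite /= -[A x]scale1r; apply: vD.
    by apply: A2; exists x.
  by apply: B2; exists x.
- move=> c A [bA A1 A2]; split; first exact: bounded_opZ.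
    by move=> _ [x xQ <-]; rewrite -[_ *: _]addr0; apply: vD => //; apply: A1; exists x.
  by move=> _ [x xQ <-]; rewrite -[_ *: _]addr0; apply: vD => //; apply: A2; exists x.
- move=> A B [bA A1 A2] [bB B1 B2]; split; first exact: bounded_op_comp.
    by move=> _ [x xQ <-]; apply: A1; exists (B x) => //; apply: B1; exists x.
  by move=> _ [x xQ <-]; apply: A2; exists (B x) => //; apply: B2; exists x.
- move=> A B [bA A1 A2] bB AB; split=> //; first exact: vanish_on_adjoint AB A2.
  apply: (vanish_on_adjoint AB).
  suff -> : vanish_on (predC (predC Q)) = vanish_on Q by [].
  by apply/seteqP; split=> x xQ b; have := xQ b; rewrite /= negbK.
- move=> A bA Acl; split=> //; apply: vanish_on_closed => r /Acl[B [? ? ?] ?];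
    by exists B.
Qed.

End ReducingSubspaces.

(** * Adjoints of the shifts and the irreducibility criterion *)

Section Multishift.
Variables (R : realType) (n : nat) (F2 : completeNormedModType R[i]).
Variable dot : {dot F2 for Num.conj}.
Hypothesis dotP : norm_from_dot dot.
Variable e : seq 'I_n -> F2.
Hypothesis e_basis : orthonormal_basis dot e.
Variables (mu : seq 'I_n -> R) (W : 'I_n -> F2 -> F2).
Hypothesis W_shift : weighted_left_multishift e mu W.

Lemma adjoint_sym (A B : F2 -> F2) : adjoint dot A B -> adjoint dot B A.
Proof. by move=> AB x y; rewrite dotC -AB -dotC. Qed.

Lemma shift_adjoint_nil i B : adjoint dot (W i) B -> B (e [::]) = 0.
Proof.
move=> WB; apply: (basis_eq0 dotP e_basis) => a; apply: dot_eq0C.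
by rewrite -WB (shift_basis W_shift) dotZl dot_basis// mulr0.
Qed.

Lemma shift_adjoint_cons i j b B : adjoint dot (W i) B ->
  B (e (j :: b)) = if i == j then ((mu (j :: b))%:C)%C *: e b else 0.
Proof.
move=> WB; apply: (basis_ext dotP e_basis) => a.
rewrite (adjoint_sym WB) (shift_basis W_shift) dotZr dot_basis// eqseq_cons.
have -> : Num.conj ((mu (i :: a))%:C)%C = ((mu (i :: a))%:C)%C :> R[i].
  by apply/CrealP; rewrite complex_real.
rewrite eq_sym; case: eqP => [->|_] /=; last by rewrite mulr0 linear0l.
by rewrite dotZl dot_basis//; case: eqP => [->|_]; rewrite ?mulr0.
Qed.

Lemma cstar_shift i : cstar_algebra dot W (W i).
Proof. by move=> S [_ WS]; apply: WS; exists i. Qed.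

Lemma cstar_shift_adjoint i B : bounded_operator B -> adjoint dot (W i) B ->
  cstar_algebra dot W B.
Proof.
move=> bB WB S [cS WS]; apply: (cstar_adjoint cS) bB WB.
by apply: WS; exists i.
Qed.

Lemma irreducible_weight_gt0 : irreducible_algebra (cstar_algebra dot W) ->
  forall beta, (1 <= size beta)%N -> 0 < mu beta.
Proof.
move=> irr [//|i g] _; rewrite lt_def (weight_ge0 W_shift)// andbT.
(* With this [Q], [vanish_on] gives the vectors supported on words ending in [i :: g]. *)
apply/negP => /eqP mu0; pose Q : pred (seq 'I_n) := fun b => ~~ suffix (i :: g) b.
have WQ : cstar_algebra dot W `<=` reduced_by dot e Q.
  apply: smallest_sub; first exact: reduced_by_cstar.
  move=> _ [j _ <-]; split; first exact: (shift_bounded W_shift).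
    move=> _ [x xQ <-] b Qb.
    have [B _ WB] := exists_adjoint dotP (shift_bounded W_shift j).
    rewrite WB; case: b Qb => [|k b] Qb; first by rewrite (shift_adjoint_nil WB) linear0r.
    rewrite (shift_adjoint_cons _ _ WB); case: eqP => [jk|_]; last by rewrite linear0r.
    (* Prepending a letter keeps a suffix, so if [k :: b] lacks it then [b] does. *)
    rewrite dotZr xQ ?mulr0//; apply: contraNN Qb => /suffixP[s ->].
    by apply/suffixP; exists (k :: s).
  move=> _ [x xQ <-] b /negbNE Qb.
  have [B _ WB] := exists_adjoint dotP (shift_bounded W_shift j).
  rewrite WB; case: b Qb => [|k b] Qb; first by rewrite (shift_adjoint_nil WB) linear0r.
  rewrite (shift_adjoint_cons _ _ WB); case: eqP => [jk|_]; last by rewrite linear0r.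
  (* Either the suffix already occurs in [b], or [k :: b] is [i :: g] itself and the weight is
     zero. *)
  have [Qb'|Qb'] := boolP (suffix (i :: g) b).
    by rewrite dotZr xQ ?mulr0//= /Q negbK.
  case/suffixP: Qb => -[[-> ->]|a s [ks bs]]; first by rewrite mu0 scale0r linear0r.
  by case/suffixP: Qb'; exists s.
have [] := irr (vanish_on dot e Q).
- exact: closed_vanish_on.
- by move=> A /WQ[].
- move=> M0; have : vanish_on dot e Q (e (i :: g)).
    by move=> b; rewrite dot_basis// /Q; case: eqP => // <-; rewrite suffix_refl.
  rewrite M0 => /= ei; have := dot_basis e_basis (i :: g) (i :: g).
  by rewrite ei linear0l eqxx => /esym/eqP; rewrite oner_eq0.
- move=> MT; have : vanish_on dot e Q (e [::]) by rewrite MT.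
  have Q0 : Q [::] by rewrite /Q suffixs0.
  move=> /(_ _ Q0); rewrite dot_basis// eqxx => /eqP.
  by rewrite oner_eq0.
Qed.

Lemma weight_gt0_irreducible :
  (forall beta, (1 <= size beta)%N -> 0 < mu beta) ->
  irreducible_algebra (cstar_algebra dot W).
Proof.
move=> mu_gt0 M csM invM; have [M0 Mlin Mcl] := csM.
have muC_neq0 j b : ((mu (j :: b))%:C)%C != 0 :> R[i].
  by rewrite gt_eqF// (ltcR 0) mu_gt0.
have WM j x : M x -> M (W j x).
  by move=> Mx; apply: (invM _ (cstar_shift j)); exists x.
have adj_ex j := exists_adjoint dotP (shift_bounded W_shift j).
have [p Mp eM] := exists_proj dotP (e [::]) csM.
(* [B] kills [e [::]], so [B p] is minus [B] of the residual [e [::] - p]; that residual is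
   orthogonal to [M], which contains [W j (B p)]. *)
have Bp0 j B : bounded_operator B -> adjoint dot (W j) B -> B p = 0.
  move=> bB WB; apply/eqP; rewrite -(dnorm_eq0 dot); apply/eqP.
  have MBp : M (B p) by apply: (invM _ (cstar_shift_adjoint bB WB)); exists p.
  have [lB _] := bB.
  have -> : dot (B p) (B p) = - dot (B (e [::] - p)) (B p).
    rewrite (linear_opB _ _ lB) (shift_adjoint_nil WB) sub0r.
    by rewrite linearNl opprK.
  by rewrite (adjoint_sym WB) eM ?oppr0//; exact: WM.
(* The coefficient of [p] at [j :: b] is, up to a nonzero factor, that of [B p] at [b], hence 0. *)
have p_vac : p = dot p (e [::]) *: e [::].
  apply: (basis_ext dotP e_basis) => -[|j b].
    by rewrite dotZl dot_basis// eqxx mulr1.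
  rewrite dotZl dot_basis// mulr0; have [B bB WB] := adj_ex j.
  have : dot p (W j (e b)) = 0 by rewrite -(adjoint_sym WB) (Bp0 _ _ bB WB) linear0l.
  rewrite (shift_basis W_shift) dotZr => /eqP; rewrite mulf_eq0 conjC_eq0.
  by rewrite (negbTE (muC_neq0 _ _)) => /eqP.
have MZ c x : M x -> M (c *: x) by move=> Mx; rewrite -[_ *: _]addr0; exact: Mlin.
have [c0|c0] := eqVneq (dot p (e [::])) 0.
(* Here [p = 0], so [M] is orthogonal to [e [::]]; invariance under the adjoints carries this to
   every [e a] by induction on [a]. *)
- left; rewrite c0 scale0r in p_vac; apply/seteqP; split=> [m Mm|_ ->//].
  apply: (basis_eq0 dotP e_basis) => a; apply: dot_eq0C.
  elim: a m Mm => [|j a IH] m Mm; first by have := eM _ Mm; rewrite p_vac subr0.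
  have [B bB WB] := adj_ex j.
  have : dot (W j (e a)) m = 0.
    rewrite WB IH//; apply: (invM _ (cstar_shift_adjoint bB WB)); by exists m.
  by rewrite (shift_basis W_shift) dotZl => /eqP; rewrite mulf_eq0
    (negbTE (muC_neq0 _ _)) => /eqP.
- right; apply/seteqP; split=> // x _.
  have Me a : M (e a).
    elim: a => [|j a IH].
      have -> : e [::] = (dot p (e [::]))^-1 *: p by rewrite {2}p_vac scalerA mulVf// scale1r.
      exact: MZ.
    have -> : e (j :: a) = (((mu (j :: a))%:C)%C)^-1 *: W j (e a).
      by rewrite (shift_basis W_shift) scalerA mulVf// scale1r.
    by apply/MZ/WM.
  apply: Mcl; apply/closure_ballP => eps /(basis_proj_dense dotP e_basis x)[s xs].
  exists (basis_proj dot e s x) => //; rewrite /basis_proj.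
  by elim/big_rec: _ => // a y _ My; apply: Mlin.
Qed.

End Multishift.

(** * Rank one operators and approximation of compact operators *)

Section CompactOperators.
Variables (R : realType) (H : completeNormedModType R[i]).
Variable dot : {dot H for Num.conj}.
Hypothesis dotP : norm_from_dot dot.
Variables (I : eqType) (e : I -> H).
Hypothesis e_basis : orthonormal_basis dot e.

Definition rank_one (z w : H) : H -> H := fun x => dot x w *: z.

Lemma bounded_rank_one z w : bounded_operator (rank_one z w).
Proof.
apply/bounded_opP; split=> [c x y|].
  by rewrite /rank_one dotDl dotZl scalerDl scalerA.
exists (`|w| * `|z| + 1); first by rewrite ltr_wpDl// mulr_ge0.
move=> x; rewrite normrZ (@le_trans _ _ (`|x| * `|w| * `|z|))//.
  by rewrite ler_wpM2r// cauchy_schwarz.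
by rewrite -mulrA mulrC ler_wpM2r// lerDl.
Qed.

(* The directed set of finite subsets of the basis replaces a finite net: the
   inequality basis_proj_best makes the approximation monotone in it. *)
Lemma compact_op_approx (K : H -> H) (r : R) : compact_operator K -> 0 < r ->
  exists s, opnorm_le (K \- (basis_proj dot e s \o K)) r.
Proof.
move=> [[lK _] /compact_near_coveringP cK] r0.
pose F := filter_from [set: seq I] (fun s => [set s' : seq I | {subset s <= s'}]).
have FF : ProperFilter F.
  apply: filter_from_proper; last by move=> s _; exists s.
  apply: filter_from_filter; first by exists [::].
  move=> s1 s2 _ _; exists (s1 ++ s2) => // s' ss'.
  by split=> a sa; apply: ss'; rewrite mem_cat sa ?orbT.
have rC0 : 0 < (r%:C)%C / 2 :> R[i] by rewrite divr_gt0// (ltcR 0).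
pose P s y := `|y - basis_proj dot e s y| <= (r%:C)%C.
(* Compactness in covering form: if near each [y] the estimate [P s] holds for all large [s], then a
   single [s] serves the whole set. *)
have /(cK _ F P FF)/filter_ex[s Ks] : forall y, closure (K @` [set x | `|x| <= 1]) y ->
    \forall y' \near y & s \near F, P s y'.
  move=> y _; have [s0 ys0] := basis_proj_dense dotP e_basis y rC0.
  exists (ball y ((r%:C)%C / 2), [set s : seq I | {subset s0 <= s}]).
    by split; [exact: nbhsx_ballx|exists s0].
  move=> [y' s] /= [+ ss]; rewrite -ball_normE /= => yy'; rewrite /P.
  apply: (le_trans (basis_proj_mono dotP e_basis y' y ss)).
  have -> : y' - basis_proj dot e s0 y = y - basis_proj dot e s0 y - (y - y').
    by rewrite opprB [RHS]addrC addrA subrK.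
  rewrite (le_trans (ler_normB _ _))// [leRHS]splitr lerD//; exact: ltW.
exists s => x.
have [->|x0] := eqVneq x 0.
  by rewrite /= (linear_op0 lK) /basis_proj big1 ?subrr ?normr0 ?mulr0// => a _;
    rewrite linear0l scale0r.
have nx0 : `|x| != 0 by rewrite normr_eq0.
have : closure (K @` [set x | `|x| <= 1]) (K (`|x|^-1 *: x)).
  apply: subset_closure; exists (`|x|^-1 *: x) => //=.
  by rewrite normrZ normfV normr_id mulVf.
move=> /Ks; rewrite /P (linear_opZ _ _ lK).
have -> : basis_proj dot e s (`|x|^-1 *: K x) = `|x|^-1 *: basis_proj dot e s (K x).
  by rewrite /basis_proj scaler_sumr; apply: eq_bigr => a _; rewrite dotZl scalerA.
rewrite -scalerBr normrZ normfV normr_id mulrC ler_pdivrMr//.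
by rewrite normr_gt0.
Qed.

Section Subalgebra.
Variable S : set (H -> H).
Hypothesis cS : unital_cstar_subalgebra dot S.

Lemma cstar_sum J (s : seq J) (F : J -> H -> H) :
  (forall j, S (F j)) -> S (fun x => \sum_(j <- s) F j x).
Proof.
move=> SF; elim: s => [|j s IH].
  have -> : (fun x => \sum_(j <- [::]) F j x) = (fun x => 0 *: idfun x).
    by apply/funext => x; rewrite big_nil scale0r.
  exact/(cstar_scale cS)/(cstar_id cS).
have -> : (fun x => \sum_(k <- j :: s) F k x) = F j \+ (fun x => \sum_(k <- s) F k x).
  by apply/funext => x; rewrite big_cons.
exact: (cstar_add cS).
Qed.

Hypothesis S_rank_one : forall a b, S (rank_one (e a) (e b)).

(** Truncating [z] to finitely many basis vectors changes the operator by at most the norm of the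
    discarded part. *)
Lemma cstar_rank_one_basisl a z : S (rank_one (e a) z).
Proof.
apply: (cstar_closed cS); first exact: bounded_rank_one.
move=> r r0; have rC0 : 0 < (r%:C)%C :> R[i] by rewrite (ltcR 0).
have [s zs] := basis_proj_dense dotP e_basis z rC0.
exists (rank_one (e a) (basis_proj dot e s z)).
  have -> : rank_one (e a) (basis_proj dot e s z) =
      (fun x => \sum_(b <- undup s) Num.conj (dot z (e b)) *: rank_one (e a) (e b) x).
    apply/funext => x; rewrite /rank_one /basis_proj dot_sumr scaler_suml.
    by apply: eq_bigr => b _; rewrite dotZr scalerA.
  by apply: cstar_sum => b; apply: (cstar_scale cS).
move=> x; rewrite /rank_one /= -scalerBl -dotBr normrZ (norm_basis dotP e_basis) mulr1.
by rewrite (le_trans (cauchy_schwarz dotP _ _))// mulrC ler_wpM2r// ltW.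
Qed.

(** With [L] the adjoint of [K], the truncation [basis_proj dot e s \o K] is a finite sum of
    operators [rank_one (e a) (L (e a))]. *)
Lemma cstar_compact (K : H -> H) : compact_operator K -> S K.
Proof.
move=> cK; have [bK _] := cK; have [L bL KL] := exists_adjoint dotP bK.
apply: (cstar_closed cS) => // r r0.
have [s Ks] := compact_op_approx cK r0.
exists (basis_proj dot e s \o K) => //.
have -> : basis_proj dot e s \o K =
    (fun x => \sum_(a <- undup s) rank_one (e a) (L (e a)) x).
  by apply/funext => x; apply: eq_bigr => a _; rewrite /rank_one KL.
by apply: cstar_sum => a; exact: cstar_rank_one_basisl.
Qed.

End Subalgebra.

(** * Diagonal operators in a C*-algebra *)

Section Diagonal.
Variable S : set (H -> H).
Hypothesis cS : unital_cstar_subalgebra dot S.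

(** Keeps only the real eigenvalues, so that operator algebra becomes pointwise algebra of
    functions. *)
Definition cstar_diag (f : I -> R) : Prop :=
  exists2 A, S A & forall a, A (e a) = ((f a)%:C)%C *: e a.

Lemma cstar_diag_cst (c : R) : cstar_diag (fun=> c).
Proof.
exists (fun x => (c%:C)%C *: idfun x) => //.
exact/(cstar_scale cS)/(cstar_id cS).
Qed.

Lemma cstar_diagD f g : cstar_diag f -> cstar_diag g -> cstar_diag (f \+ g).
Proof.
move=> [A SA Af] [B SB Bg]; exists (A \+ B); first exact: (cstar_add cS).
by move=> a; rewrite /= Af Bg -scalerDl -rmorphD.
Qed.

Lemma cstar_diagM f g : cstar_diag f -> cstar_diag g -> cstar_diag (f \* g).
Proof.
move=> [A SA Af] [B SB Bg]; exists (A \o B); first exact: (cstar_comp cS).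
move=> a; have [lA _] := cstar_bounded cS SA.
by rewrite /= Bg (linear_opZ _ _ lA) Af scalerA -rmorphM mulrC.
Qed.

Lemma cstar_diagX f k : cstar_diag f -> cstar_diag (fun a => f a ^+ k).
Proof.
move=> Sf; elim: k => [|k IH]; first exact: cstar_diag_cst.
have -> : (fun a => f a ^+ k.+1) = f \* (fun a => f a ^+ k).
  by apply/funext => a; rewrite exprS.
exact: cstar_diagM.
Qed.

(** By [diag_opnorm], uniform approximation of the entries is approximation in operator norm. *)
Lemma cstar_diag_closed (A : H -> H) (f : I -> R) : bounded_operator A ->
  (forall a, A (e a) = ((f a)%:C)%C *: e a) ->
  (forall r : R, 0 < r -> exists2 g, cstar_diag g & forall a, `|f a - g a| <= r) ->
  S A.
Proof.
move=> bA Af fcl; apply: (cstar_closed cS) => // r r0.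
have [g [B SB Bg] fg] := fcl r r0; exists B => // x.
have bN : bounded_operator (A \- B).
  have -> : A \- B = A \+ (fun x => -1 *: B x) by apply/funext => y; rewrite /= scaleN1r.
  exact/bounded_opD/bounded_opZ/(cstar_bounded cS).
apply: (diag_opnorm dotP e_basis (d := fun a => ((f a - g a)%:C)%C)) => //.
- by rewrite (lecR 0) ltW.
- by move=> a; rewrite /= Af Bg -scalerBl -rmorphB.
- move=> a; rewrite normc_def /= expr0n addr0 sqrtr_sqr lecR; exact: fg.
Qed.

End Diagonal.

End CompactOperators.

(** * Uniform estimates on the weights *)

Section WordEstimates.
Variables (R : realType) (n : nat).
Implicit Types f mu : seq 'I_n -> R.

(** There are finitely many words of each length, so the minimum is taken length by length. *)
Lemma short_words_lb f (N : nat) : (forall alpha, 0 < f alpha) ->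
  exists2 delta, 0 < delta & forall alpha, (size alpha < N)%N -> delta <= f alpha.
Proof.
move=> f0; elim: N => [|N [delta delta0 IH]]; first by exists 1.
exists (Num.min delta (\big[Num.min/1]_(t : N.-tuple 'I_n) f t)).
  by rewrite lt_min delta0; apply: lt_bigmin.
move=> alpha; rewrite ltnS leq_eqVlt => /orP[/eqP sN|/IH fa]; last first.
  by rewrite ge_min fa.
have := bigmin_le 1 (in_tuple alpha) (fun t : (size alpha).-tuple 'I_n => f t).
by rewrite -sN ge_min => ->; rewrite orbT.
Qed.

Lemma nonempty_words_ub mu :
  (forall i, has_ubound (range (fun alpha => mu (i :: alpha)))) ->
  exists2 C, 0 < C & forall i alpha, mu (i :: alpha) <= C.
Proof.
move=> mu_ub; have /choice[M muM] : forall i, exists M, forall alpha, mu (i :: alpha) <= M.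
  by move=> i; have [M iM] := mu_ub i; exists M => alpha; apply: iM; exists alpha.
exists (\sum_i `|M i| + 1); first by rewrite ltr_wpDl// sumr_ge0.
move=> i alpha; rewrite (le_trans (muM _ _))// (le_trans (ler_norm _))//.
by rewrite (bigD1 i)//= -addrA lerDl addr_ge0// sumr_ge0.
Qed.

(* t is the diagonal of \sum_j W_j W_j^*, and alpha |-> mu (i :: alpha) ^+ 2
   that of W_i^* W_i. *)
Lemma vacuum_gap mu i : (forall j alpha, 0 < mu (j :: alpha)) ->
  (forall j, has_ubound (range (fun alpha => mu (j :: alpha)))) ->
  (fun alpha => mu (i :: alpha) - mu alpha) @ @words_infty n --> (0 : R) ->
  let t alpha := if alpha is [::] then 0 else mu alpha ^+ 2 in
  let E alpha := t alpha + (mu (i :: alpha) ^+ 2 - t alpha - mu [:: i] ^+ 2) ^+ 2 in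
  exists c, exists2 q, `|q| < 1 &
    forall j alpha, `|1 - c * E (j :: alpha)| <= q.
Proof.
move=> mu0 mu_ub mu_lim t E.
have [C C0 muC] := nonempty_words_ub mu_ub.
pose d := mu [:: i] ^+ 2.
have d0 : 0 < d by rewrite exprn_gt0.
have mu_le_E j alpha : mu (j :: alpha) ^+ 2 <= E (j :: alpha).
  by rewrite /E /t lerDl sqr_ge0.
(* On long words the limit condition bounds the difference of the squared weights by [d / 2], so the
   quantity squared in [E] is at most [- (d / 2)]. *)
have [N EN] : exists N, forall j alpha, (N <= size (j :: alpha))%N ->
    (d / 2) ^+ 2 <= E (j :: alpha).
  (* Two weights sum to at most [2 * C], so this tolerance keeps the difference of their squares
     below [d / 2]. *)
  have eps0 : 0 < d / (4 * C) by rewrite divr_gt0// mulr_gt0.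
  have [N _ muN] := mu_lim _ (nbhsx_ballx (0 : R) _ eps0).
  exists N => j alpha /muN; rewrite -ball_normE /= sub0r normrN ltr_pdivlMr ?mulr_gt0//.
  move: (mu0 i (j :: alpha)) (mu0 j alpha) (muC i (j :: alpha)) (muC j alpha).
  rewrite /E /t -/d; set a := mu (i :: _); set b := mu (j :: _) => a0 b0 aC bC.
  move=> ab; have abd : a ^+ 2 - b ^+ 2 <= d / 2.
    have p1 : 0 <= (`|a - b| - (a - b)) * (a + b).
      by rewrite mulr_ge0 ?subr_ge0 ?ler_norm// addr_ge0// ltW.
    have p2 : 0 <= `|a - b| * (C + C - (a + b)).
      by rewrite mulr_ge0// subr_ge0 lerD.
    move: ab p1 p2; set u := `|a - b|; nra.
  apply: (@le_trans _ _ ((a ^+ 2 - b ^+ 2 - d) ^+ 2)); last by rewrite lerDr sqr_ge0.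
  rewrite -[leRHS]sqrrN; apply: lerXn2r; rewrite ?nnegrE; lra.
(* On the finitely many short words [mu_le_E] gives the lower bound; the value 1 at the empty word
   only makes the function positive everywhere. *)
have [delta delta0 deltaN] :=
  @short_words_lb (fun alpha => if alpha is [::] then 1 else mu alpha ^+ 2) N
    (fun alpha => if alpha is j :: a then exprn_gt0 2 (mu0 j a) else ltr01).
pose m := Num.min delta ((d / 2) ^+ 2).
have m0 : 0 < m by rewrite lt_min delta0 exprn_gt0// divr_gt0.
have mE j alpha : m <= E (j :: alpha).
  have [/EN Ed|/deltaN] := leqP N (size (j :: alpha)); first by rewrite ge_min Ed orbT.
  by move=> dE; rewrite ge_min (le_trans dE).
(* An upper bound for [E], as squared weights lie between 0 and [C ^+ 2]. The witness for the
   conclusion is its inverse, which scales the entries into the interval from [m / c] to 1. *)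
pose c := C ^+ 2 + (C ^+ 2 + d) ^+ 2.
have Ec j alpha : E (j :: alpha) <= c.
  rewrite /E /t -/d /c; apply: lerD; first by rewrite lerXn2r// nnegrE ltW.
  have a2 k beta : 0 <= mu (k :: beta) ^+ 2 <= C ^+ 2.
    by rewrite sqr_ge0 lerXn2r// nnegrE ltW.
  have := a2 i (j :: alpha); have := a2 j alpha.
  set a := _ ^+ 2; set b := mu (i :: _) ^+ 2; set C2 := C ^+ 2.
  move=> /andP[? ?] /andP[? ?]; nra.
have c0 : 0 < c by apply: lt_le_trans m0 (le_trans (mE i [::]) (Ec i [::])).
have mc : m / c <= 1 by rewrite ler_pdivrMr// mul1r (le_trans (mE i [::])).
have mc0 : 0 < m / c by rewrite divr_gt0.
exists c^-1, (1 - m / c); first by rewrite ger0_norm; lra.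
move=> j alpha.
have Ecl : m / c <= c^-1 * E (j :: alpha) by rewrite mulrC ler_pM2l ?invr_gt0.
have Ecu : c^-1 * E (j :: alpha) <= 1 by rewrite mulrC ler_pdivrMr// mul1r.
by rewrite ger0_norm; lra.
Qed.

End WordEstimates.

(** * The projection on the vacuum vector and the rank one operators *)

Section VacuumProjection.
Variables (R : realType) (n : nat) (F2 : completeNormedModType R[i]).
Variable dot : {dot F2 for Num.conj}.
Hypothesis dotP : norm_from_dot dot.
Variable e : seq 'I_n -> F2.
Hypothesis e_basis : orthonormal_basis dot e.
Variables (mu : seq 'I_n -> R) (W : 'I_n -> F2 -> F2).
Hypothesis W_shift : weighted_left_multishift e mu W.

Lemma injective_weight_gt0 : (forall i, injective (W i)) ->
  forall i alpha, 0 < mu (i :: alpha).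
Proof.
move=> Winj i alpha; rewrite lt_def (weight_ge0 W_shift)// andbT.
apply/negP => /eqP mu0; have [lW _] := shift_bounded W_shift i.
have /Winj e0 : W i (e alpha) = W i 0.
  by rewrite (shift_basis W_shift) mu0 scale0r (linear_op0 lW).
have := dot_basis e_basis alpha alpha.
by rewrite e0 linear0l eqxx => /esym/eqP; rewrite oner_eq0.
Qed.

Variable S : set (F2 -> F2).
Hypothesis cS : unital_cstar_subalgebra dot S.
Hypothesis S_shift : forall i, S (W i).

Lemma cstar_shift_adjointE i :
  exists2 B, S B & adjoint dot (W i) B.
Proof.
have [B bB WB] := exists_adjoint dotP (shift_bounded W_shift i).
by exists B => //; apply: (cstar_adjoint cS) bB WB.
Qed.

(** On [e (k :: a)] only the summand [j = k] survives, and on [e [::]] none does. *)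
Lemma cstar_diag_range :
  cstar_diag e S (fun alpha => if alpha is [::] then 0 else mu alpha ^+ 2).
Proof.
have /choice[B SB] : forall j, exists B, S B /\ adjoint dot (W j) B.
  by move=> j; have [B ? ?] := cstar_shift_adjointE j; exists B.
exists (fun x => \sum_(j <- index_enum 'I_n) (W j \o B j) x).
  apply: (cstar_sum cS _ (F := fun j => W j \o B j)) => j.
  by apply: (cstar_comp cS); [exact: S_shift|case: (SB j)].
have W0 j : W j 0 = 0 by apply: linear_op0; case: (shift_bounded W_shift j).
case=> [|k a].
  rewrite scale0r big1// => j _ /=.
  by rewrite (shift_adjoint_nil dotP e_basis W_shift (SB j).2) W0.
rewrite (bigD1 k)//= big1 => [|j jk] /=;
  rewrite (shift_adjoint_cons dotP e_basis W_shift _ _ (SB _).2).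
  rewrite eqxx addr0; have [lW _] := shift_bounded W_shift k.
  by rewrite (linear_opZ _ _ lW) (shift_basis W_shift) scalerA -rmorphM.
by rewrite (negbTE jk) W0.
Qed.

Lemma cstar_diag_domain i : cstar_diag e S (fun alpha => mu (i :: alpha) ^+ 2).
Proof.
have [B SB WB] := cstar_shift_adjointE i.
exists (B \o W i) => [|a]; first exact: (cstar_comp cS).
have [lB _] := cstar_bounded cS SB.
rewrite /= (shift_basis W_shift) (linear_opZ _ _ lB).
by rewrite (shift_adjoint_cons dotP e_basis W_shift _ _ WB) eqxx scalerA -rmorphM.
Qed.

Hypothesis mu_gt0 : forall i alpha, 0 < mu (i :: alpha).

Lemma cstar_vacuum_projection i :
  (fun alpha => mu (i :: alpha) - mu alpha) @ @words_infty n --> (0 : R) ->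
  S (rank_one dot (e [::]) (e [::])).
Proof.
move=> mu_lim.
have [c [q q1 Eq0]] := vacuum_gap mu_gt0 (weight_bounded W_shift) mu_lim.
pose t alpha := if alpha is [::] then 0 else mu alpha ^+ 2.
pose E alpha := t alpha + (mu (i :: alpha) ^+ 2 - t alpha - mu [:: i] ^+ 2) ^+ 2.
have {Eq0}Eq j a : `|1 - c * E (j :: a)| <= q := Eq0 j a.
apply: (cstar_diag_closed dotP e_basis cS (f := fun alpha => (alpha == [::])%:R)).
- exact: bounded_rank_one.
- move=> a; rewrite /rank_one dot_basis//.
  by case: eqP => [->|_] //=; rewrite !scale0r.
move=> r r0.
have [k qk] : exists k, `|q ^+ k| < r.
  have [k _ kq] := cvg_expr q1 (nbhsx_ballx (0 : R) _ r0).
  by exists k; have := kq _ (leqnn k); rewrite -ball_normE /= sub0r normrN.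
exists (fun alpha => (1 - c * E alpha) ^+ k.+1).
  apply: (cstar_diagX cS).
  (* Rewritten with pointwise sums, products and powers of constants and the two known diagonals, so
     that the closure lemmas apply. *)
  have -> : (fun alpha => 1 - c * E alpha) =
      (fun=> 1) \+ ((fun=> - c) \* (t \+ (fun alpha => ((fun alpha => mu (i :: alpha) ^+ 2) \+
         ((fun=> -1) \* t) \+ (fun=> - mu [:: i] ^+ 2)) alpha ^+ 2))).
    by apply/funext => a; rewrite /E /= !mulNr mul1r.
  apply: (cstar_diagD cS); first exact: (cstar_diag_cst _ cS).
  apply: (cstar_diagM cS); first exact: (cstar_diag_cst _ cS).
  have St : cstar_diag e S t := cstar_diag_range.
  apply: (cstar_diagD cS) => //; apply: (cstar_diagX cS).
  apply: (cstar_diagD cS); last exact: (cstar_diag_cst _ cS).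
  apply: (cstar_diagD cS); first exact: cstar_diag_domain.
  by apply: (cstar_diagM cS) => //; exact: (cstar_diag_cst _ cS).
case=> [|j a].
  (* At the empty word [E] is 0, thanks to the subtracted [mu [:: i] ^+ 2], so every power is
     exactly 1. *)
  by rewrite /E /t subr0 subrr expr0n addr0 mulr0 subr0 expr1n subrr normr0 ltW.
rewrite sub0r normrN normrX exprSr.
have q0 : 0 <= q := le_trans (normr_ge0 _) (Eq j a).
rewrite ger0_norm ?exprn_ge0// in qk; rewrite ger0_norm// in q1.
apply: le_trans (ltW qk); rewrite -[leRHS]mulr1 ler_pM ?exprn_ge0//.
  by rewrite lerXn2r// nnegrE.
by rewrite (le_trans (Eq j a))// ltW.
Qed.

(** Composing on the left with [W j] lengthens [a], and on the right with its adjoint lengthens [b];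
    the nonzero weights are divided out. *)
Lemma cstar_rank_one_basis : S (rank_one dot (e [::]) (e [::])) ->
  forall a b, S (rank_one dot (e a) (e b)).
Proof.
move=> S0; have muC_neq0 j b : ((mu (j :: b))%:C)%C != 0 :> R[i].
  by rewrite gt_eqF// (ltcR 0).
have muC_real j b : Num.conj ((mu (j :: b))%:C)%C = ((mu (j :: b))%:C)%C :> R[i].
  by apply/CrealP; rewrite complex_real.
elim=> [|j a IH] b; last first.
  have -> : rank_one dot (e (j :: a)) (e b) =
      (fun x => ((mu (j :: a))%:C)%C^-1 *: (W j \o rank_one dot (e a) (e b)) x).
    apply/funext => x; have [lW _] := shift_bounded W_shift j.
    rewrite /rank_one /= (linear_opZ _ _ lW) (shift_basis W_shift) !scalerA.
    by rewrite mulrAC mulVf// mul1r.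
  exact/(cstar_scale cS)/(cstar_comp cS).
elim: b => [//|j b IH].
have [B SB WB] := cstar_shift_adjointE j.
have -> : rank_one dot (e [::]) (e (j :: b)) =
    (fun x => ((mu (j :: b))%:C)%C^-1 *: (rank_one dot (e [::]) (e b) \o B) x).
  apply/funext => x; rewrite /rank_one /= (adjoint_sym WB) (shift_basis W_shift).
  by rewrite dotZr muC_real scalerA mulKf.
exact/(cstar_scale cS)/(cstar_comp cS).
Qed.

End VacuumProjection.

(** * Convergence along words of growing length *)

Lemma words_infty_filter n : Filter (@words_infty n).
Proof.
apply: filter_from_filter; first by exists 0%N.
move=> N1 N2 _ _; exists (maxn N1 N2) => // alpha /=.
by rewrite geq_max => /andP[].
Qed.

(** Prepending a letter only lengthens a word, so both terms have the same limit [l]. *)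
Lemma cvg_weight_diff (R : realType) n (mu : seq 'I_n -> R) (l : R) (i : 'I_n) :
  mu @ @words_infty n --> l ->
  (fun alpha => mu (i :: alpha) - mu alpha) @ @words_infty n --> (0 : R).
Proof.
have FF := words_infty_filter n; move=> mul.
rewrite -(subrr l); apply: cvgB; last exact: mul.
move=> U /mul[N _ NU]; exists N => // alpha /= Nalpha.
exact/NU/leqW.
Qed.

Unset Implicit Arguments.

Theorem theorem1p14 (R : realType) (n : nat) (n_ge1 : (1 <= n)%N)
    (F2 : completeNormedModType R[i]) (dot : {dot F2 for Num.conj})
    (F2_hilbert : norm_from_dot dot)
    (e : seq 'I_n -> F2) (e_basis : orthonormal_basis dot e)
    (mu : seq 'I_n -> R) (W : 'I_n -> F2 -> F2)
    (W_shift : weighted_left_multishift e mu W) :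
  (irreducible_algebra (cstar_algebra dot W) <->
     (forall beta : seq 'I_n, (1 <= size beta)%N -> 0 < mu beta)) /\
  ((forall i : 'I_n, injective (W i)) ->
     (exists i : 'I_n,
        (fun alpha => mu (i :: alpha) - mu alpha) @ @words_infty n --> (0 : R)) ->
     forall K : F2 -> F2, compact_operator K -> cstar_algebra dot W K) /\
  ((exists l : R, mu @ @words_infty n --> l) ->
     forall i : 'I_n,
       (fun alpha => mu (i :: alpha) - mu alpha) @ @words_infty n --> (0 : R)).
Proof.
split; last split.
- split; first exact: (irreducible_weight_gt0 F2_hilbert e_basis W_shift).
  exact: (weight_gt0_irreducible F2_hilbert e_basis W_shift).
(* Membership in the generated algebra is tested in an arbitrary C*-algebra [S] containing the
   shifts. *)
- move=> Winj [i mu_lim] K cK S [cS WS].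
  have mu_gt0 := injective_weight_gt0 e_basis W_shift Winj.
  have SW j : S (W j) by apply: WS; exists j.
  apply: (cstar_compact F2_hilbert e_basis cS) => //.
  apply: (cstar_rank_one_basis F2_hilbert W_shift cS SW mu_gt0).
  exact: (cstar_vacuum_projection F2_hilbert e_basis W_shift cS SW mu_gt0 mu_lim).
- by move=> [l mul] i; exact: cvg_weight_diff mul.
Qed.
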